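(* Let $0<\alpha\leq 1$ and let $d_E^\alpha(x,y)=|x-y|^\alpha$ for $x,y\in\mathbb{R}$. Let $m\geq 1$ be the unique solution to the equation $(m-1)^\alpha+(m+1)^\alpha=2$. Then $C_0(\mathbb{R},d_E^\alpha)=m^\alpha$.
   Context: For a metric space $(X,d)$ and $\mu \geq 0$, say that $(X,d)$ satisfies the $(\mu,0)$-four-point inequality if for all $x,y,z,w\in X$, $d(x,y)+d(z,w)\le \mu\max\{d(x,z)+d(y,w),\ d(x,w)+d(y,z)\}$. The quadrilateral constant of $(X,d)$ is $C_0(X,d)=\inf\{\mu\geq 0 \mid (X,d)\text{ satisfies the }(\mu,0)\text{-four-point inequality}\}$. *)

(* Defs.v *)
From HB Require Import structures.
From mathcomp Require Import all_boot all_order all_algebra.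
From mathcomp Require Import all_classical all_reals all_analysis.
From mathcomp Require Import lra.

Set Implicit Arguments.
Unset Strict Implicit.
Unset Printing Implicit Defensive.

Import Order.TTheory GRing.Theory Num.Theory.
Import numFieldNormedType.Exports.

Local Open Scope classical_set_scope.
Local Open Scope ring_scope.

(* The (mu, 0)-four-point inequality. *)
Definition four_point (R : realType) (X : metricType R) (mu : R) : Prop :=
  forall x y z w : X,
    mdist x y + mdist z w <=
      mu * Num.max (mdist x z + mdist y w) (mdist x w + mdist y z).

(* The quadrilateral constant C_0(X, d). The real-valued [inf] is a junk value
   on sets that are empty or not bounded below; [has_inf_four_point] shows that
   this never happens here. *)
Definition quadrilateral_constant (R : realType) (X : metricType R) : R :=
  inf [set mu : R | 0 <= mu /\ four_point X mu].

Lemma four_point2 (R : realType) (X : metricType R) : four_point X 2.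
Proof.
move=> x y z w; set M := Num.max _ _.
have h1 : mdist x z + mdist y w <= M by rewrite le_max lexx.
have h2 : mdist x w + mdist y z <= M by rewrite le_max lexx orbT.
have a1 := metric_triangle x z y; have a2 := metric_triangle x w y.
have b1 := metric_triangle z x w; have b2 := metric_triangle z y w.
rewrite (metric_sym z y) in a1 b2; rewrite (metric_sym w y) in a2.
rewrite (metric_sym z x) in b1.
by lra.
Qed.

Lemma has_inf_four_point (R : realType) (X : metricType R) :
  has_inf [set mu : R | 0 <= mu /\ four_point X mu].
Proof.
split; first by exists 2; split => //; exact: four_point2.
by exists 0 => mu [].
Qed.

(* The metric space (R, d) with d x y = |x - y|^alpha. The proof that alpha lies
   in ]0, 1] is a parameter of the type because [d] is a metric only then. *)
Definition snowflake (R : realType) (alpha : R) (halpha : 0 < alpha <= 1) :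
  Type := R.

Section snowflake_metric.
Context (R : realType) (alpha : R) (halpha : 0 < alpha <= 1).
Local Notation S := (snowflake halpha).

Definition snowflake_dist (x y : S) : R := `|(x : R) - (y : R)| `^ alpha.

Let alpha_neq0 : alpha != 0.
Proof. by case/andP: halpha => /gt_eqF ->. Qed.

Lemma powR_subadditive (a b : R) : 0 <= a -> 0 <= b ->
  (a + b) `^ alpha <= a `^ alpha + b `^ alpha.
Proof.
case/andP: halpha => _ al1 a0 b0.
have [->|sN0] := eqVneq (a + b) 0.
  by rewrite powR0// addr_ge0// powR_ge0.
have s0 : 0 < a + b by rewrite lt_neqAle eq_sym sN0 addr_ge0.
have aux c : 0 <= c -> c <= a + b ->
    (a + b) `^ alpha * (c / (a + b)) <= c `^ alpha.
  move=> c0 cs.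
  have [->|cN0] := eqVneq c 0; first by rewrite mul0r mulr0 powR_ge0.
  have -> : c `^ alpha = (a + b) `^ alpha * (c / (a + b)) `^ alpha.
    have q0 : 0 <= c / (a + b) by rewrite divr_ge0// ltW.
    by rewrite -powRM ?(ltW s0)// mulrCA divff// mulr1.
  have cgt0 : 0 < c by rewrite lt_neqAle eq_sym cN0.
  rewrite ler_wpM2l ?powR_ge0// ger1_powR//.
  by rewrite divr_gt0//= ler_pdivrMr// mul1r.
apply: le_trans (lerD (aux a _ _) (aux b _ _)); rewrite ?lerDl ?lerDr//.
by rewrite -mulrDr -mulrDl divff// mulr1.
Qed.

Let distxx x : snowflake_dist x x = 0.
Proof. by rewrite /snowflake_dist subrr normr0 powR0. Qed.

Let dist_eq0 x y : snowflake_dist x y = 0 -> x = y.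
Proof. by move=> /powR_eq0_eq0/normr0_eq0/eqP; rewrite subr_eq0 => /eqP. Qed.

Let dist_sym x y : snowflake_dist x y = snowflake_dist y x.
Proof. by rewrite /snowflake_dist distrC. Qed.

Let dist_triangle y x z :
  snowflake_dist x z <= snowflake_dist x y + snowflake_dist y z.
Proof.
apply: le_trans (powR_subadditive (normr_ge0 _) (normr_ge0 _)).
by case/andP: halpha => /ltW al0 _;
  rewrite ge0_ler_powR ?nnegrE ?addr_ge0// ler_distD.
Qed.

HB.instance Definition _ := Choice.copy S R.
HB.instance Definition _ :=
  @isMetric.Build R S snowflake_dist distxx dist_eq0 dist_sym dist_triangle.

End snowflake_metric.

Lemma snowflake_mdistE (R : realType) (alpha : R) (halpha : 0 < alpha <= 1)
  (x y : snowflake halpha) :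
  mdist x y = `|(x : R) - (y : R)| `^ alpha.
Proof. by []. Qed.

(* Main.v *)
Require Import Defs.
From HB Require Import structures.
From mathcomp Require Import all_boot all_order all_algebra.
From mathcomp Require Import all_classical all_reals all_analysis.
From mathcomp Require Import ring lra.
Import Order.TTheory GRing.Theory Num.Theory.
Import numFieldNormedType.Exports.
Local Open Scope ring_scope.

(** Write [k] for the exponent. Four points of the line, with consecutive gaps
    [p], [q], [r], can be paired in three ways, with distance sums
    - [p `^ k + r `^ k] (separated pairs),
    - [(p + q) `^ k + (q + r) `^ k] (crossing pairs),
    - [q `^ k + (p + q + r) `^ k] (nested pairs).

    The crossing sum is the largest, by monotonicity and concavity of the power,
    so the quadrilateral constant is the supremum of the ratio of the crossing
    sum to the maximum of the two others. The gaps [1], [m - 1], [1] give the ratio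
    [m `^ k] ([four_point_ge]). What remains is that no configuration exceeds it
    ([crossing_le]).

    The main idea is to compare a configuration with the symmetric one
    of the same cross-ratio, whose gaps are [1], [u - 1], [1] with
    [u ^+ 2 = (p + q) * (q + r) / (p * r)]. Both ratios, separated to crossing and
    nested to crossing, are smallest at the symmetric configuration
    ([crossing_le_separated], [crossing_le_nested]), where they are [u `^ - k] and
    [((u - 1) `^ k + (u + 1) `^ k) / (2 * u `^ k)]. The first decreases in [u], the
    second increases, and they take the same value [m `^ - k] at [u = m].

    The comparison of nested with crossing sums is the hard one. Writing each
    pair of distances as [s * expR t], [s * expR (- t)] turns it into the
    statement that [cosh c = cosh a * cosh b] implies
    [cosh (k a) * cosh (k b) <= cosh (k c)] ([cosh_scale_mul]). This is the
    concavity of [cosh (k u)] as a function of [cosh u], which holds because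
    [sinh (k u) / sinh u] decreases ([sinh_scale_ratio_le]). *)

(** * Hyperbolic functions *)

Definition cosh {R : realType} (x : R) : R := (expR x + expR (- x)) / 2.
Definition sinh {R : realType} (x : R) : R := (expR x - expR (- x)) / 2.

Lemma coshN {R : realType} (x : R) : cosh (- x) = cosh x.
Proof. by rewrite /cosh opprK addrC. Qed.

Lemma cosh0 {R : realType} : cosh (0 : R) = 1.
Proof. by rewrite /cosh oppr0 expR0; field. Qed.

Lemma sinh0 {R : realType} : sinh (0 : R) = 0.
Proof. by rewrite /sinh oppr0 subrr mul0r. Qed.

Lemma coshD {R : realType} (x y : R) :
  cosh (x + y) = cosh x * cosh y + sinh x * sinh y.
Proof. by rewrite /cosh /sinh opprD !expRD; field. Qed.

Lemma coshB {R : realType} (x y : R) :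
  cosh (x - y) = cosh x * cosh y - sinh x * sinh y.
Proof. by rewrite /cosh /sinh opprB !expRD; field. Qed.

Lemma cosh_gt0 {R : realType} (x : R) : 0 < cosh x.
Proof. by rewrite /cosh divr_gt0// addr_gt0// expR_gt0. Qed.

Lemma sinh_ge0 {R : realType} (x : R) : 0 <= x -> 0 <= sinh x.
Proof. by move=> x0; rewrite /sinh divr_ge0// subr_ge0 ler_expR; lra. Qed.

Lemma sinh_gt0 {R : realType} (x : R) : 0 < x -> 0 < sinh x.
Proof. by move=> x0; rewrite /sinh divr_gt0// subr_gt0 ltr_expR; lra. Qed.

Lemma is_derive_expR_scale {R : realType} (k x : R) :
  is_derive x 1 (fun u : R => expR (k * u)) (k * expR (k * x)).
Proof.
have -> : (fun u : R => expR (k * u)) = expR \o ( *%R k) by [].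
apply: is_derive_eq.
by rewrite /GRing.scale/= mulr1 mulrC.
Qed.

Lemma is_derive_cosh_scale {R : realType} (k x : R) :
  is_derive x 1 (fun u : R => cosh (k * u)) (k * sinh (k * x)).
Proof.
have h1 := is_derive_expR_scale k x; have h2 := is_derive_expR_scale (- k) x.
have -> : (fun u : R => cosh (k * u)) =
    (2^-1 : R) \*: ((fun u : R => expR (k * u)) \+ (fun u => expR (- k * u))).
  by apply/funext => u; rewrite /cosh /= mulNr /GRing.scale/= mulrC.
apply: is_derive_eq.
by rewrite /sinh /GRing.scale/= !mulNr; field.
Qed.

Lemma is_derive_sinh_scale {R : realType} (k x : R) :
  is_derive x 1 (fun u : R => sinh (k * u)) (k * cosh (k * x)).
Proof.
have h1 := is_derive_expR_scale k x; have h2 := is_derive_expR_scale (- k) x.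
have -> : (fun u : R => sinh (k * u)) =
    (2^-1 : R) \*: ((fun u : R => expR (k * u)) \- (fun u => expR (- k * u))).
  by apply/funext => u; rewrite /sinh /= mulNr /GRing.scale/= mulrC.
apply: is_derive_eq.
by rewrite /cosh /GRing.scale/= !mulNr; field.
Qed.

Lemma ge0_is_derive_le {R : realType} (f df : R -> R) (a b : R) :
  (forall x, a <= x <= b -> is_derive x 1 f (df x)) ->
  (forall x, a < x < b -> 0 <= df x) -> a <= b -> f a <= f b.
Proof.
move=> fdf df0; rewrite le_eqVlt => /predU1P[->//|ab].
have cf : {within `[a, b], continuous f}%classic.
  apply: derivable_within_continuous => x; rewrite in_itv/= => xab.
  by have [] := fdf _ xab.
have [x xab|c] := @MVT _ f df a b ab _ cf.
  by apply: fdf; move: xab; rewrite in_itv/= => /andP[/ltW-> /ltW->].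
rewrite in_itv/= => /df0 c0 fE.
by rewrite -subr_ge0 fE mulr_ge0// subr_ge0 ltW.
Qed.

(** The numerator of the derivative of [sinh (k x) / sinh x], up to sign. The
    difference of the two sides vanishes at [0] and has derivative
    [(1 - k ^+ 2) * sinh (k x) * sinh x >= 0]. *)
Lemma sinh_scale_derive_le {R : realType} (k x : R) : 0 <= k <= 1 -> 0 <= x ->
  k * cosh (k * x) * sinh x <= sinh (k * x) * cosh x.
Proof.
move=> /andP[k0 k1] x0.
pose f (u : R) := sinh (k * u) * cosh (1 * u) - k * (cosh (k * u) * sinh (1 * u)).
pose df (u : R) := (1 - k ^+ 2) * sinh (k * u) * sinh u.
suff : f 0 <= f x.
  by rewrite /f !mulr0 sinh0 cosh0 !mul1r !mulr0 mul0r subrr subr_ge0 !mulrA.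
apply: (@ge0_is_derive_le _ _ df) => // [u _|u /andP[u0 _]].
  have h1 := is_derive_sinh_scale k u; have h2 := is_derive_cosh_scale k u.
  have h3 := is_derive_sinh_scale 1 u; have h4 := is_derive_cosh_scale 1 u.
  have -> : f = ((fun u : R => sinh (k * u)) * (fun u => cosh (1 * u)))
    - k \*: ((fun u : R => cosh (k * u)) * (fun u => sinh (1 * u))).
    by apply/funext => v.
  apply: is_derive_eq.
  by rewrite /df /GRing.scale/= !mul1r; ring.
rewrite /df -mulrA; apply: mulr_ge0; first by rewrite subr_ge0 expr_le1.
by apply: mulr_ge0; apply: sinh_ge0; rewrite ?mulr_ge0 ?(ltW u0).
Qed.

Lemma sinh_scale_ratio_le {R : realType} (k x y : R) : 0 <= k <= 1 ->
  0 < x <= y -> sinh (k * y) * sinh x <= sinh (k * x) * sinh y.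
Proof.
move=> k01 /andP[x0 xy].
pose f (u : R) := - (sinh (k * u) / sinh (1 * u)).
pose df (u : R) :=
  (sinh (k * u) * cosh u - k * cosh (k * u) * sinh u) / (sinh u) ^+ 2.
have : f x <= f y.
  apply: (@ge0_is_derive_le _ f df x y) => [u /andP[xu _]|u /andP[xu _]|//].
    have u0 : 0 < u := lt_le_trans x0 xu.
    have su0 : sinh u != 0 by rewrite gt_eqF// sinh_gt0.
    have su0' : sinh (1 * u) != 0 by rewrite mul1r.
    have h1 := is_derive_sinh_scale k u; have h3 := is_derive_sinh_scale 1 u.
    have h4 := @is_deriveV _ (fun v => sinh (1 * v)) _ _ _ su0' h3.
    have -> : f = - ((fun u : R => sinh (k * u)) * (fun u => (sinh (1 * u))^-1)).
      by apply/funext => v.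
    apply: is_derive_eq.
    by rewrite /df /GRing.scale/= !mul1r; field.
  have u0 := lt_trans x0 xu.
  by rewrite /df divr_ge0// ?sqr_ge0// subr_ge0 sinh_scale_derive_le// ltW.
rewrite /f !mul1r lerN2 ler_pdivrMr ?sinh_gt0// ?(lt_le_trans x0)//.
by rewrite mulrAC ler_pdivlMr ?sinh_gt0.
Qed.

(** As a function of [z = cosh u], [cosh (k u)] is concave: its slope
    [k sinh (k u) / sinh u] decreases. The right-hand side is the tangent at
    [z = cosh c]. *)
Lemma cosh_scale_tangent {R : realType} (k c u : R) : 0 <= k <= 1 -> 0 < c ->
  cosh (k * u) <=
    cosh (k * c) + k * sinh (k * c) / sinh c * (cosh u - cosh c).
Proof.
move=> k01 c0; wlog u0 : u / 0 <= u => [th|].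
  have [/th//|u0] := leP 0 u.
  by rewrite -(coshN u) -(coshN (k * u)) -mulrN th// oppr_ge0 ltW.
have /andP[k0 k1] := k01.
set s := k * sinh (k * c) / sinh c.
have sc0 := sinh_gt0 c c0.
pose f (v : R) := s * cosh (1 * v) - cosh (k * v).
pose df (v : R) := k / sinh c * (sinh (k * c) * sinh v - sinh (k * v) * sinh c).
have fdf (v : R) : is_derive v 1 f (df v).
  have h1 := is_derive_cosh_scale 1 v; have h2 := is_derive_cosh_scale k v.
  have -> : f = s \*: (fun v : R => cosh (1 * v)) - (fun v => cosh (k * v)).
    by apply/funext.
  apply: is_derive_eq.
  rewrite /df /s /GRing.scale/= !mul1r; field.
  by rewrite gt_eqF.
have ks0 : 0 <= k / sinh c by rewrite divr_ge0// ltW.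
suff : f c <= f u by rewrite /f !mul1r; lra.
have [cu|uc] := leP c u.
  apply: (@ge0_is_derive_le _ f df c u) => [v /andP[cv _]|//].
  by rewrite /df mulr_ge0// subr_ge0 sinh_scale_ratio_le// c0 ltW.
rewrite -lerN2.
apply: (@ge0_is_derive_le _ (- f) (- df) u c) => [v /andP[uv vc]|].
- by rewrite oppr_ge0 /df mulr_ge0_le0// subr_le0 sinh_scale_ratio_le//
    (le_lt_trans u0 uv) ltW.
- exact: ltW.
Qed.

(** With the product fixed, the sum grows as the two factors move apart:
    [(x - b) * (x - c) >= 0]. *)
Lemma addr_le_of_eq_mul {R : realType} (x y b c : R) : 0 < x -> x * y = b * c ->
  b <= x -> c <= x -> b + c <= x + y.
Proof.
move=> x0 xy bx cx; rewrite -(ler_pM2l x0) [leRHS]mulrDr xy.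
have : 0 <= (x - b) * (x - c) by rewrite mulr_ge0 ?subr_ge0.
by lra.
Qed.

Lemma cosh_scale_le {R : realType} (k x : R) : 0 <= k <= 1 ->
  cosh (k * x) <= cosh x.
Proof.
move=> /andP[k0 k1]; wlog x0 : x / 0 <= x => [th|].
  have [/th//|x0] := leP 0 x.
  by rewrite -(coshN x) -(coshN (k * x)) -mulrN th// oppr_ge0 ltW.
rewrite /cosh ler_pM2r//; apply: addr_le_of_eq_mul; first exact: expR_gt0.
- by rewrite -!expRD !subrr.
- by rewrite ler_expR ler_piMl.
- by rewrite ler_expR (@le_trans _ _ 0)// oppr_le0 mulr_ge0.
Qed.

(** Since [2 * cosh a * cosh b = cosh (a + b) + cosh (a - b)], the number
    [cosh c] is the mean of the values of [cosh] at [a + b] and [a - b], and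
    [cosh (k a) * cosh (k b)] is the mean of the values of [cosh (k _)] there.
    The claim is thus the concavity of [cosh (k u)] in [cosh u]. *)
Lemma cosh_scale_mul {R : realType} (k a b c : R) : 0 <= k <= 1 ->
  cosh a * cosh b = cosh c -> cosh (k * a) * cosh (k * b) <= cosh (k * c).
Proof.
move=> k01; wlog c0 : c / 0 <= c => [th|].
  have [/th//|c0] := leP 0 c.
  by rewrite -(coshN c) -(coshN (k * c)) -mulrN => /th; apply; rewrite oppr_ge0 ltW.
move: c0; rewrite le_eqVlt => /predU1P[<-|c0] abc.
  (* The slope of the tangent is a quotient by [sinh c], which vanishes here. *)
  by rewrite mulr0 -abc ler_pM ?cosh_scale_le// ltW// cosh_gt0.
(* The tangent at [cosh c] is affine in [cosh u], so its terms cancel when the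
   instances [u = a + b] and [u = a - b] are added. *)
have := cosh_scale_tangent k c (a + b) k01 c0.
have := cosh_scale_tangent k c (a - b) k01 c0.
rewrite !(mulrBr k, mulrDr k) !coshB !coshD -abc.
set s := k * _ / _.
by lra.
Qed.

(** * Sums of two powers *)

(** The exponent [k^-1 >= 1] gives a convex power; applying its convexity to
    [x `^ k] and [y `^ k] and taking [k]-th powers yields concavity. *)
Lemma powR_concave {R : realType} (k t x y : R) : 0 < k <= 1 -> 0 <= t <= 1 ->
  0 <= x -> 0 <= y ->
  t * x `^ k + (1 - t) * y `^ k <= (t * x + (1 - t) * y) `^ k.
Proof.
move=> /andP[k0 k1] /andP[t0 t1] x0 y0.
have kV1 : 1 <= k^-1 by rewrite invf_ge1.
have powK z : 0 <= z -> (z `^ k) `^ k^-1 = z.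
  by move=> z0; rewrite -powRrM mulfV ?gt_eqF// powRr1.
have s0 : 0 <= t * x `^ k + (1 - t) * y `^ k.
  by rewrite addr_ge0 ?mulr_ge0 ?powR_ge0 ?subr_ge0.
have := @convex_powR R _ kV1 (Itv01 t0 t1) (x `^ k) (y `^ k).
rewrite convRE [X in X `^ _ <= _]convRE/= /unstable.onem !powK// => h.
have -> : t * x `^ k + (1 - t) * y `^ k =
    ((t * x `^ k + (1 - t) * y `^ k) `^ k^-1) `^ k.
  by rewrite -powRrM mulVf ?gt_eqF// powRr1.
rewrite ge0_ler_powR ?nnegrE ?powR_ge0 ?(ltW k0)//.
  by rewrite addr_ge0// mulr_ge0// subr_ge0.
by apply: h; rewrite inE/= in_itv/= powR_ge0.
Qed.

(** A concave function has the smaller sum on the pair that is more spread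
    out, the total being the same. *)
Lemma powR_spread_le {R : realType} (k a b c d : R) : 0 < k <= 1 -> 0 <= a ->
  a <= b <= d -> a + d = b + c -> a `^ k + d `^ k <= b `^ k + c `^ k.
Proof.
move=> k01 a0 /andP[ab bd] adbc.
have [ad|ad] := eqVneq a d.
  have -> : b = a by lra.
  by have -> : c = d by lra.
have da : 0 < d - a by rewrite subr_gt0 lt_neqAle ad (le_trans ab).
pose t := (d - b) / (d - a).
have t01 : 0 <= t <= 1.
  apply/andP; split; first by apply: divr_ge0; lra.
  by rewrite ler_pdivrMr// mul1r; lra.
have d0 : 0 <= d by lra.
have := powR_concave k t a d k01 t01 a0 d0.
have := powR_concave k t d a k01 t01 d0 a0.
have -> : t * a + (1 - t) * d = b by rewrite /t; field; rewrite gt_eqF.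
have -> : t * d + (1 - t) * a = c.
  have -> : c = a + d - b by lra.
  by rewrite /t; field; rewrite gt_eqF.
by lra.
Qed.

(** For equal products it is the more spread pair that has the larger sum of
    powers, the opposite of [powR_spread_le]. *)
Lemma powR_equal_mul_le {R : realType} (k x y b c : R) : 0 <= k -> 0 < x -> 
  0 <= y -> 0 <= b <= x -> 0 <= c <= x -> x * y = b * c ->
  b `^ k + c `^ k <= x `^ k + y `^ k.
Proof.
move=> k0 x0 y0 /andP[b0 bx] /andP[c0 cx] xy.
apply: addr_le_of_eq_mul; first exact: powR_gt0.
- by rewrite -!powRM ?xy// ltW.
- by rewrite ge0_ler_powR ?nnegrE// ltW.
- by rewrite ge0_ler_powR ?nnegrE// ltW.
Qed.

(** Here [s] is the geometric mean of [x] and [y]. In these coordinates sums and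
    sums of powers are hyperbolic cosines, up to a factor [2 * s] or
    [2 * s `^ k]. *)
Lemma polar_pair {R : realType} (x y : R) : 0 < x -> 0 < y ->
  exists2 s : R, 0 < s & exists t : R, x = s * expR t /\ y = s * expR (- t).
Proof.
move=> x0 y0; exists (expR ((ln x + ln y) / 2)); first exact: expR_gt0.
exists ((ln x - ln y) / 2); rewrite -!expRD; split.
  by rewrite -[LHS]lnK ?posrE//; congr expR; field.
by rewrite -[LHS]lnK ?posrE//; congr expR; field.
Qed.

Lemma polar_pair_powR {R : realType} (k s t : R) : 0 < s ->
  (s * expR t) `^ k + (s * expR (- t)) `^ k = 2 * s `^ k * cosh (k * t).
Proof.
move=> s0; rewrite !powRM ?expR_ge0 ?(ltW s0)// -!expRM mulNr /cosh.
by rewrite (mulrC t k); field.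
Qed.

Lemma polar_pair_add {R : realType} (s t : R) :
  s * expR t + s * expR (- t) = 2 * s * cosh t.
Proof. by rewrite /cosh; field. Qed.

Lemma polar_pair_mul {R : realType} (s t : R) :
  s * expR t * (s * expR (- t)) = s ^+ 2.
Proof. by rewrite mulrACA expRxMexpNx_1 mulr1. Qed.

(** Let [X], [Y], [Z] be uniform on [{a, a'}], [{b, b'}], [{c, c'}], with [X] and
    [Y] independent. If [Z] has the mean and the geometric mean of [X * Y], then
    [E ((X * Y) `^ k) <= E (Z `^ k)]. In the coordinates of [polar_pair] the
    hypotheses read [s2 = s * s1] and [cosh t2 = cosh t * cosh t1], so this is
    [cosh_scale_mul]. *)
Lemma powR_pair_mul_le {R : realType} (k a a' b b' c c' : R) : 0 <= k <= 1 ->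
  0 < a -> 0 < a' -> 0 < b -> 0 < b' -> 0 < c -> 0 < c' ->
  (a + a') * (b + b') = 2 * (c + c') -> a * a' * (b * b') = c * c' ->
  (a `^ k + a' `^ k) * (b `^ k + b' `^ k) <= 2 * (c `^ k + c' `^ k).
Proof.
move=> k01 a0 a'0 b0 b'0 c0 c'0.
have [s s0 [t [-> ->]]] := polar_pair a a' a0 a'0.
have [s1 s10 [t1 [-> ->]]] := polar_pair b b' b0 b'0.
have [s2 s20 [t2 [-> ->]]] := polar_pair c c' c0 c'0.
rewrite !polar_pair_add !polar_pair_mul !polar_pair_powR// => sumE mulE.
have s2E : s2 = s * s1.
  apply/esym/eqP; rewrite -(@eqrXn2 _ 2) ?(ltW s20)//.
    by rewrite exprMn mulE.
  by rewrite mulr_ge0// ltW.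
have cE : cosh t * cosh t1 = cosh t2.
  have ss1 : 4 * (s * s1) != 0 by rewrite gt_eqF// !mulr_gt0.
  apply: (mulfI ss1); move: sumE; rewrite s2E; lra.
rewrite s2E powRM ?(ltW s0) ?(ltW s10)//.
have := cosh_scale_mul k t t1 t2 k01 cE.
have : 0 <= 4 * (s `^ k * s1 `^ k) by rewrite !mulr_ge0 ?powR_ge0.
move=> /ler_wpM2l h /h; lra.
Qed.

(** * Four points on a line *)

Lemma powR_ge1 {R : realType} (k m : R) : 0 <= k -> 1 <= m -> 1 <= m `^ k.
Proof.
move=> k0 m1; have -> : 1 = 1 `^ k by rewrite powR1.
by rewrite ge0_ler_powR// nnegrE// (le_trans ler01).
Qed.

(** Scaling [p] and [r] by [u] gives a pair with the same product as [p + q],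
    [q + r], and more spread out: adding [q] to both entries of a pair brings
    their ratio closer to [1], while scaling preserves it. *)
Lemma crossing_le_separated {R : realType} (k u p q r : R) : 0 <= k -> 0 < u ->
  0 < p -> 0 <= q -> 0 < r -> u ^+ 2 * (p * r) = (p + q) * (q + r) ->
  (p + q) `^ k + (q + r) `^ k <= u `^ k * (p `^ k + r `^ k).
Proof.
move=> k0 u0; wlog rp : p r / r <= p => [th p0 q0 r0 uE|p0 q0 r0 uE].
  have [/th|/ltW pr] := leP r p; first exact.
  rewrite addrC (addrC q) (addrC p) (addrC (p `^ k)); apply: th => //.
  by rewrite (mulrC r) uE; ring.
(* After squaring and clearing [p + q], this is [q * r <= q * p]. *)
have pqu : p + q <= u * p.
  have pq0 : 0 <= p + q by rewrite addr_ge0// ltW.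
  have up0 : 0 <= u * p by rewrite mulr_ge0// ltW.
  rewrite -(@ler_pXn2r _ 2)// -(ler_pM2r r0).
  have -> : (u * p) ^+ 2 * r = (p + q) * (p * (q + r)).
    by rewrite mulrCA -uE; ring.
  rewrite expr2 -mulrA ler_pM2l ?ltr_wpDr//.
  have : q * r <= q * p by rewrite ler_wpM2l.
  by lra.
rewrite mulrDr -!powRM ?(ltW u0) ?(ltW p0) ?(ltW r0)//.
apply: powR_equal_mul_le => //.
- exact: mulr_gt0.
- by rewrite mulr_ge0 ?ltW.
- by rewrite pqu addr_ge0// ltW.
- apply/andP; split; first by rewrite addr_ge0// ltW.
  by apply: le_trans pqu; lra.
- by rewrite mulrACA -uE.
Qed.

(** The gaps [1], [u - 1], [1] form the symmetric configuration with the same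
    cross-ratio as [p], [q], [r]. The pairs [(u - 1, u + 1)], [(p + q, q + r)] and
    [(u * q, u * (p + q + r))] satisfy the hypotheses of [powR_pair_mul_le]: the
    condition on products follows from Ptolemy's identity
    [(p + q) * (q + r) = p * r + q * (p + q + r)]. Hence the ratio of the nested
    sum to the crossing sum is at least its value in the symmetric
    configuration. *)
Lemma crossing_le_nested {R : realType} (k u p q r : R) : 0 <= k <= 1 -> 1 < u ->
  0 < p -> 0 < q -> 0 < r -> u ^+ 2 * (p * r) = (p + q) * (q + r) ->
  ((u - 1) `^ k + (u + 1) `^ k) * ((p + q) `^ k + (q + r) `^ k) <=
  2 * (u `^ k * (q `^ k + (p + q + r) `^ k)).
Proof.
move=> k01 u1 p0 q0 r0 uE.
have u0 : 0 < u by lra.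
have d0 : 0 < p + q + r by rewrite !addr_gt0.
rewrite (mulrDr (u `^ k)) -!powRM ?(ltW u0) ?(ltW q0) ?(ltW d0)//.
apply: powR_pair_mul_le => //; rewrite ?subr_gt0 ?addr_gt0 ?mulr_gt0//.
  by ring.
rewrite -uE.
have -> : (u - 1) * (u + 1) * (u ^+ 2 * (p * r)) =
  u ^+ 2 * (u ^+ 2 * (p * r) - p * r) by ring.
by rewrite uE; ring.
Qed.

(** That is, [((u - 1) `^ k + (u + 1) `^ k) / u `^ k] increases with [u]: the pair
    [1 - u^-1], [1 + u^-1] becomes less spread out. *)
Lemma scaled_sum_le {R : realType} (k m u : R) : 0 < k <= 1 -> 1 <= m <= u ->
  u `^ k * ((m - 1) `^ k + (m + 1) `^ k) <=
  m `^ k * ((u - 1) `^ k + (u + 1) `^ k).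
Proof.
move=> k01 /andP[m1 mu].
have m0 : 0 <= m by lra.
have u0 : 0 <= u by lra.
rewrite 2!mulrDr -!powRM//; try lra.
apply: powR_spread_le => //.
- by rewrite mulr_ge0// subr_ge0.
- by apply/andP; split; lra.
- by ring.
Qed.

(** The inverse cross-ratio [u ^+ 2 = (p + q) * (q + r) / (p * r)] decides which of
    the two other sums to use: the separated one if [u <= m], the nested one if
    [m <= u]. *)
Lemma crossing_le {R : realType} (k m p q r : R) : 0 < k <= 1 ->
  1 <= m -> (m - 1) `^ k + (m + 1) `^ k = 2 -> 0 <= p -> 0 <= q -> 0 <= r ->
  (p + q) `^ k + (q + r) `^ k <=
    m `^ k * Num.max (p `^ k + r `^ k) (q `^ k + (p + q + r) `^ k).
Proof.
move=> k01 m1 mE p0 q0 r0; set M := Num.max _ _.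
have /andP[k0 k1] := k01.
have le1M : p `^ k + r `^ k <= M by rewrite le_max lexx.
have le2M : q `^ k + (p + q + r) `^ k <= M by rewrite le_max lexx orbT.
have mk1 := powR_ge1 k m (ltW k0) m1.
have M0 : 0 <= M by apply: le_trans le1M; rewrite addr_ge0 ?powR_ge0.
have MmM : M <= m `^ k * M by rewrite ler_peMl.
have [qE|qN0] := eqVneq q 0.
  by rewrite qE addr0 add0r (le_trans le1M).
have [pE|pN0] := eqVneq p 0.
  by apply: le_trans MmM; apply: le_trans le2M; rewrite pE !add0r.
have [rE|rN0] := eqVneq r 0.
  by apply: le_trans MmM; apply: le_trans le2M; rewrite rE !addr0 addrC.
have {}p0 : 0 < p by rewrite lt0r pN0.
have {}q0 : 0 < q by rewrite lt0r qN0.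
have {}r0 : 0 < r by rewrite lt0r rN0.
have pr0 : 0 < p * r by rewrite mulr_gt0.
(* A vanishing gap makes the crossing sum equal to one of the others; now the
   cross-ratio is defined and [1 < u]. *)
pose v := (p + q) * (q + r) / (p * r).
have v1 : 1 < v.
  have := mulr_gt0 p0 q0; have := mulr_gt0 q0 r0; have := mulr_gt0 q0 q0.
  by rewrite /v ltr_pdivlMr// mul1r; lra.
pose u := Num.sqrt v.
have u1 : 1 < u by rewrite -[ltLHS]sqrtr1 ltr_sqrt// (lt_trans _ v1).
have uE : u ^+ 2 * (p * r) = (p + q) * (q + r).
  by rewrite sqr_sqrtr ?(le_trans _ (ltW v1))// /v divfK// gt_eqF.
have u0 : 0 < u by lra.
have [um|/ltW mu] := leP u m.
  apply: le_trans (crossing_le_separated k u p q r (ltW k0) u0 p0 (ltW q0) r0 uE) _.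
  apply: ler_pM => //; rewrite ?powR_ge0 ?addr_ge0 ?powR_ge0//.
  by rewrite ge0_ler_powR ?nnegrE// ltW// (lt_le_trans u0).
have k01' : 0 <= k <= 1 by rewrite ltW.
have := crossing_le_nested k u p q r k01' u1 p0 q0 r0 uE.
have := scaled_sum_le k m u k01; rewrite m1 mu mE => /(_ isT).
set S2 := (p + q) `^ k + _; set S3 := q `^ k + _; set T := (u - 1) `^ k + _.
move=> uT TS.
have S20 : 0 <= S2 by rewrite addr_ge0 ?powR_ge0.
have uk0 : 0 < u `^ k by apply: powR_gt0.
apply: (@le_trans _ _ (m `^ k * S3)); last by rewrite ler_wpM2l ?powR_ge0.
rewrite -(ler_pM2l uk0).
have h1 := ler_wpM2r S20 uT.
have h2 := ler_wpM2l (powR_ge0 m k) TS.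
by lra.
Qed.

(** By symmetry one may take [x <= y], [z <= w] and [x <= z]. The pairs [{x, y}] and
    [{z, w}] are then separated, crossing or nested. Only the crossing case uses
    the equation for [m]; in the others monotonicity or concavity shows that the
    sum is at most the crossing one. *)
Lemma line_four_point {R : realType} (k m : R) : 0 < k <= 1 ->
  1 <= m -> (m - 1) `^ k + (m + 1) `^ k = 2 -> forall x y z w : R,
  `|x - y| `^ k + `|z - w| `^ k <=
    m `^ k * Num.max (`|x - z| `^ k + `|y - w| `^ k)
                     (`|x - w| `^ k + `|y - z| `^ k).
Proof.
move=> k01 m1 mE x y z w.
have /andP[k0 k1] := k01.
have mk1 := powR_ge1 k m (ltW k0) m1.
have mono (a b : R) : 0 <= a -> a <= b -> a `^ k <= b `^ k.
  by move=> a0 ab; rewrite ge0_ler_powR ?nnegrE ?(ltW k0)// (le_trans a0).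
have le_max1 (a b c : R) : 0 <= a -> a <= b -> a <= m `^ k * Num.max b c.
  move=> a0 ab; rewrite (le_trans ab)// (@le_trans _ _ (Num.max b c))//.
    by rewrite le_max lexx.
  by rewrite ler_peMl// le_max (le_trans a0 ab).
wlog xy : x y / x <= y => [th|].
  have [/th//|/ltW /th] := leP x y.
  by rewrite (distrC y x) maxC (addrC (`|y - w| `^ k)) (addrC (`|y - z| `^ k)).
wlog zw : z w / z <= w => [th|].
  have [/th//|/ltW /th] := leP z w.
  by rewrite (distrC w z) maxC.
wlog xz : x y z w xy zw / x <= z => [th|].
  have [xz|/ltW zx] := leP x z; first exact: (th x y z w).
  move: (th z w x y zw xy zx).
  rewrite (addrC (`|z - w| `^ k)) (distrC z x) (distrC w y) (distrC z y) (distrC w x).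
  by rewrite (addrC (`|y - z| `^ k)).
rewrite (distrC x y) (distrC z w) (distrC x z) (distrC x w).
have h (a b : R) : a <= b -> `|b - a| = b - a.
  by move=> ab; rewrite ger0_norm ?subr_ge0.
have [yz|/ltW zy] := leP y z.
  rewrite (distrC y w) (distrC y z) !h ?(le_trans yz)// ?(le_trans xz)//.
  apply: le_max1; first by rewrite addr_ge0 ?powR_ge0.
  by apply: lerD; apply: mono; lra.
have [yw|/ltW wy] := leP y w.
  rewrite (distrC y w) !h ?(le_trans xz)//.
  have := crossing_le k m (z - x) (y - z) (w - y) k01 m1 mE.
  rewrite !subr_ge0 => /(_ xz zy yw).
  have -> : z - x + (y - z) = y - x by ring.
  have -> : y - z + (w - y) = w - z by ring.
  have -> : y - x + (w - y) = w - x by ring.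
  by rewrite (addrC ((w - x) `^ k)).
rewrite !h ?(le_trans xz)// maxC.
apply: le_max1; first by rewrite addr_ge0 ?powR_ge0.
rewrite addrC; apply: powR_spread_le => //; rewrite ?subr_ge0//.
  by apply/andP; split; lra.
by ring.
Qed.

(** * The equation for [m] *)

Lemma continuous_powR_gt0 {R : realType} (k x : R) : 0 < x ->
  {for x, continuous (@powR R ^~ k)}%classic.
Proof.
move=> x0; apply/differentiable_continuous/derivable1_diffP.
by apply: derivable_powR; rewrite in_itv/= andbT.
Qed.

Lemma within_continuous_powR {R : realType} (k b : R) : 0 < k -> 0 < b ->
  {within `[0, b], continuous (@powR R ^~ k)}%classic.
Proof.
move=> k0 b0; apply/continuous_within_itvP => //; split.
- by move=> x; rewrite in_itv/= => /andP[x0 _]; exact: continuous_powR_gt0.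
- by rewrite powR0 ?gt_eqF//; exact: powR_cvg0.
- by apply: cvg_at_left_filter; exact: continuous_powR_gt0.
Qed.

(** Intermediate value theorem on [1 <= m <= 2]: the left-hand side is
    [2 `^ k <= 2] at [m = 1] and [1 + 3 `^ k >= 2] at [m = 2]. *)
Lemma shifted_powR_eq_exists {R : realType} (k : R) : 0 < k <= 1 ->
  exists m : R, 1 <= m /\ (m - 1) `^ k + (m + 1) `^ k = 2.
Proof.
move=> /andP[k0 k1].
(* The variable is [t = m - 1], so that the only power evaluated at [0] is
   that of the first summand. *)
pose f : R -> R := (@powR R ^~ k) \+ (fun t => (t + 2) `^ k).
have cf : {within `[0, 1], continuous f}%classic.
  apply: within_continuousD; first exact: within_continuous_powR.
  apply: continuous_in_subspaceT => x; rewrite inE/= in_itv/= => /andP[x0 _].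
  apply: (@continuous_comp R R R (fun t => t + 2) (@powR R ^~ k)).
    by apply: cvgD; [exact: cvg_id|exact: cvg_cst].
  by apply: continuous_powR_gt0; lra.
have f0 : f 0 <= 2.
  by rewrite /f/= powR0 ?gt_eqF// !add0r ler1_powR// ler1n.
have f1 : 2 <= f 1.
  have h : 1 <= (1 + 2) `^ k by apply: powR_ge1; lra.
  by rewrite /f/= powR1; lra.
have [||t] := @IVT R f 0 1 2 _ cf; first exact: ler01.
  by rewrite ge_min f0 le_max f1 orbT.
rewrite in_itv/= => /andP[t0 _] ft; exists (t + 1); split; first lra.
by rewrite addrK -addrA.
Qed.

Lemma shifted_powR_eq_inj {R : realType} (k m n : R) : 0 < k ->
  1 <= m -> 1 <= n ->
  (m - 1) `^ k + (m + 1) `^ k = (n - 1) `^ k + (n + 1) `^ k -> m = n.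
Proof.
move=> k0; wlog mn : m n / m <= n => [th m1 n1 E|m1 n1 E].
  by have [/th|/ltW /th h] := leP m n; [exact|rewrite h].
apply/eqP; rewrite eq_le mn/= leNgt; apply/negP => {}mn.
suff : (m - 1) `^ k + (m + 1) `^ k < (n - 1) `^ k + (n + 1) `^ k.
  by rewrite E ltxx.
by apply: ltrD; apply: gt0_ltr_powR; rewrite ?nnegrE; lra.
Qed.

(** * The quadrilateral constant *)

(** The points [0], [1], [m], [m + 1] attain the bound: the crossing sum is
    [2 * m `^ k], and by the choice of [m] both other sums equal [2]. *)
Lemma four_point_ge {R : realType} (k m mu : R) (k01 : 0 < k <= 1) :
  1 <= m -> (m - 1) `^ k + (m + 1) `^ k = 2 ->
  four_point (snowflake k01) mu -> m `^ k <= mu.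
Proof.
move=> m1 mE /(_ (0 : R) m (1 : R) (m + 1)); rewrite !snowflake_mdistE.
have h (a b : R) : a <= b -> `|a - b| = b - a.
  by move=> ab; rewrite distrC ger0_norm ?subr_ge0.
rewrite (distrC m 1) !h; try lra.
have -> : m - 0 = m by ring.
have -> : m + 1 - 1 = m by ring.
have -> : 1 - 0 = 1 :> R by ring.
have -> : m + 1 - m = 1 by ring.
have -> : m + 1 - 0 = m + 1 by ring.
rewrite (addrC ((m + 1) `^ k)) mE !powR1 maxxx.
by lra.
Qed.

Theorem theorem6p6 (R : realType) (alpha : R) (halpha : 0 < alpha <= 1) :
  (exists! m : R, 1 <= m /\ (m - 1) `^ alpha + (m + 1) `^ alpha = 2) /\
  (forall m : R, 1 <= m -> (m - 1) `^ alpha + (m + 1) `^ alpha = 2 ->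
    quadrilateral_constant (snowflake halpha) = m `^ alpha).
Proof.
split.
  have [m [m1 mE]] := shifted_powR_eq_exists alpha halpha.
  exists m; split=> // n [n1 nE].
  case/andP: halpha => alpha0 _.
  by apply: (shifted_powR_eq_inj alpha) => //; rewrite mE nE.
move=> m m1 mE; apply/eqP; rewrite eq_le; apply/andP; split.
  apply: ge_inf; first by exists 0 => mu [].
  split; first exact: powR_ge0.
  by move=> x y z w; rewrite !snowflake_mdistE; exact: line_four_point.
apply: lb_le_inf; first by have [] := has_inf_four_point (snowflake halpha).
by move=> mu [_ /(four_point_ge alpha m mu halpha m1 mE)].
Qed.
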